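(* Let $a,b$ be multiplicatively independent positive integers, $\Sigma:=\{a^nb^m:n,m\in\mathbb Z_{\ge0}\}$, and let $\epsilon>0$. Put $g(q):=(\log^*q)^{1+\epsilon}$ and $$\mathrm{Bad}_{\times a,\times b}(g):=\{\alpha\in\mathbb R:\ \exists c>0\ \forall q\in\Sigma,\ \|q\alpha\|\ge c\,(g(q))^{-1}\}.$$ Then $\mathrm{Bad}_{\times a,\times b}(g)\cap[0,1]$ is $\frac{\epsilon}{1+\epsilon}$-Cantor-winning on the ball $[0,1]$.
   Context: $\|x\|$ is the distance from $x$ to the nearest integer; $\log^*q:=1$ if $q<e$ and $\log^*q:=\log q$ otherwise. Cantor-winning is with respect to the canonical splitting structure of $\mathbb R$: $U=\mathbb N$, $f(u)=u$, and for a closed interval $B$, $\mathcal S(B,u)$ is the set of $u$ closed subintervals obtained by dividing $B$ into $u$ equal pieces. Generalised Cantor sets: given a closed interval $B$, $R\in\mathbb N$ and reals $\mathbf r=(r_{m,n})_{0\le m\le n}$, set $\mathcal B_0=\{B\}$; given $\mathcal B_n$, let $\mathcal I_{n+1}=\bigcup_{B_n\in\mathcal B_n}\mathcal S(B_n,R)$, $\mathcal I^{n+1}_{n+1}:=\mathcal I_{n+1}$, and for $k=0,\dots,n$ obtain $\mathcal I^{n-k}_{n+1}\subseteq\mathcal I^{n-k+1}_{n+1}$ by removing, for each $B_{n-k}\in\mathcal B_{n-k}$, at most $r_{n-k,n}$ intervals from $\mathcal S(B_{n-k},R^{k+1})\cap\mathcal I^{n-k+1}_{n+1}$; put $\mathcal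 B_{n+1}:=\mathcal I^0_{n+1}$. Any resulting $\bigcap_n\bigcup_{b\in\mathcal B_n}b$ is a $(B,R,\mathbf r)$-Cantor set. A set $K$ is $\epsilon_0$-Cantor-winning on $B$ if for every $0<\epsilon'<\epsilon_0$ there is $R_{\epsilon'}$ such that for all integers $R\ge R_{\epsilon'}$, $K$ contains some $(B,R,\mathbf r)$-Cantor set with $r_{m,n}=f(R)^{(n-m+1)(1-\epsilon')}$ for all $0\le m\le n$. *)

(* Defs.v *)
From HB Require Import structures.
From mathcomp Require Import all_boot all_order all_algebra.
From mathcomp Require Import all_classical all_reals all_analysis.

Set Implicit Arguments.
Unset Strict Implicit.
Unset Printing Implicit Defensive.

Import Order.TTheory GRing.Theory Num.Theory.

Local Open Scope classical_set_scope.
Local Open Scope ring_scope.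

Section CantorSets.
Variable R : realType.

(* The pair (x, y) stands for the closed interval [x, y]. *)
Definition cinterval : Type := (R * R)%type.

Definition cset (b : cinterval) : set R := `[b.1, b.2]%classic.

(* The canonical splitting structure of R has U = nat and f(u) = u. *)
Definition splitf (u : nat) : R := u%:R.

Definition split_point (b : cinterval) (u i : nat) : R :=
  b.1 + i%:R * ((b.2 - b.1) / u%:R).

Definition splitS (b : cinterval) (u : nat) : set cinterval :=
  [set (split_point b u i, split_point b u i.+1) | i in `I_u].

Definition card_at_most (T : Type) (A : set T) (x : R) : Prop :=
  exists2 k : nat, (k%:R <= x)%R & (A #<= `I_k)%card.

(* J' arises from J by removing, for each b in C, at most x intervals from
   splitS b u `&` J. *)
Definition removal (C : set cinterval) (u : nat) (x : R)
    (J J' : set cinterval) : Prop :=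
  exists X : cinterval -> set cinterval,
    (forall b, C b -> X b `<=` splitS b u `&` J /\ card_at_most (X b) x) /\
    J' = J `\` \bigcup_(b in C) X b.

(* Bs n is the collection B_n and Is n m is the collection I^m_(n+1), which
   passes from m = n.+1 down to m = 0 by one removal step per level. *)
Definition cantor_set (B : cinterval) (N : nat) (r : nat -> nat -> R)
    (K : set R) : Prop :=
  exists (Bs : nat -> set cinterval) (Is : nat -> nat -> set cinterval),
    [/\ Bs 0%N = [set B],
        forall n, Is n n.+1 = \bigcup_(b in Bs n) splitS b N,
        forall n m, (m <= n)%N ->
          removal (Bs m) (N ^ (n - m).+1)%N (r m n) (Is n m.+1) (Is n m),
        forall n, Bs n.+1 = Is n 0%N
      & K = \bigcap_n \bigcup_(b in Bs n) cset b].

Definition cantor_winning (eps0 : R) (B : cinterval) (K : set R) : Prop :=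
  forall eps' : R, 0 < eps' -> eps' < eps0 ->
    exists N0 : nat, forall N : nat, (N0 <= N)%N ->
      exists2 C : set R,
        cantor_set B N
          (fun m n => splitf N `^ ((n - m).+1%:R * (1 - eps'))) C
        & C `<=` K.

Definition dist_int (x : R) : R :=
  inf [set `|x - k%:~R| | k in [set: int]].

Definition logstar (q : R) : R := if q < expR 1 then 1 else ln q.

Definition Bad (a b : nat) (g : R -> R) : set R :=
  [set alpha | exists2 c : R, 0 < c &
    forall q : nat, (exists n m : nat, q = (a ^ n * b ^ m)%N) ->
      c * (g q%:R)^-1 <= dist_int (q%:R * alpha)].

End CantorSets.

Definition mult_indep (a b : nat) : Prop :=
  forall n m : int, (a%:R : rat) ^ n * (b%:R : rat) ^ m = 1 ->
    n = 0 /\ m = 0.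

(* Main.v *)
(* Group the [q] in [Sigma] by [m] with [N^m <= q < N^(m+1)]: as [a, b >= 2],
   there are only [O(m+1)] exponent pairs in each group, for fixed [N]. Choose
   [t] with [N^t] comparable to [(m+1)^(1+eps)], hence to [g q], and a constant
   [D]. With the Bad constant of order [N^-D], the points to avoid for a given
   [q] form neighbourhoods of radius at most [N^-(m+t+D)] around the [p/q], so
   they meet only [O(m+1)] intervals of level [m+t+D] inside an interval of
   level [m]. The allowance is [N^((t+D)(1-eps'))], and
   [N^(t(1-eps')) >= (m+1)] because [1-eps' >= 1/(1+eps)], while [D] large
   absorbs the factors depending on [N]. *)
Require Import Defs.
From HB Require Import structures.
From mathcomp Require Import all_boot all_order all_algebra.
From mathcomp Require Import all_classical all_reals all_analysis.
From mathcomp Require Import ring lra zify.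

Set Implicit Arguments.
Unset Strict Implicit.
Unset Printing Implicit Defensive.

Import Order.TTheory GRing.Theory Num.Theory.

Local Open Scope classical_set_scope.
Local Open Scope ring_scope.

Lemma card_le_range (T : finType) (U : Type) (f : T -> U) (A : set U) :
  A `<=` range f -> (A #<= `I_#|T|)%card.
Proof.
move=> Af; have [x0 _|T0] := pickP (@predT T); last first.
  suff -> : A = set0 by [].
  by apply/seteqP; split=> // u /Af[x]; have := T0 x.
apply: card_le_trans (card_image_le (fun i => f (nth x0 (enum T) i)) _).
apply: subset_card_le => _ /Af[x _ <-].
exists (index x (enum T)); last by rewrite nth_index ?mem_enum.
by rewrite /= cardE index_mem mem_enum.
Qed.

(** * Cantor sets built from prescribed families of discarded intervals *)

Section Splitting.
Variable R : realType.
Implicit Types (B b : cinterval R) (N u v m n : nat).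

Lemma splitS1 b : splitS b 1 b.
Proof.
exists 0%N => //=.
by rewrite /split_point !divr1 mul0r addr0 mul1r addrC subrK -surjective_pairing.
Qed.

Lemma splitS_trans b b1 b2 u v : (0 < u)%N -> (0 < v)%N ->
  splitS b u b1 -> splitS b1 v b2 -> splitS b (u * v) b2.
Proof.
move=> u0 v0 [i /= iu <-] [j /= jv <-]; exists (i * v + j)%N.
  rewrite /=; nia.
have u0' : u%:R != 0 :> R by rewrite pnatr_eq0 -lt0n.
have v0' : v%:R != 0 :> R by rewrite pnatr_eq0 -lt0n.
rewrite /split_point /= -!natr1 !natrD !natrM.
by congr pair; field; rewrite u0' v0'.
Qed.

Lemma splitS_width b b' u : splitS b u b' -> b'.2 - b'.1 = (b.2 - b.1) / u%:R.
Proof. by move=> [i _ <-]; rewrite /split_point /= -natr1; ring. Qed.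

Lemma splitS_exp_step b b1 b2 N n : (0 < N)%N ->
  splitS b (N ^ n) b1 -> splitS b1 N b2 -> splitS b (N ^ n.+1) b2.
Proof.
by move=> N0; rewrite expnSr; apply: splitS_trans => //; rewrite expn_gt0 N0.
Qed.

Section Survivors.
Variables (B : cinterval R) (N : nat) (H : nat -> nat -> set (cinterval R)).

(* [H m n] is the set of intervals to be discarded when passing from level [n]
   to level [n.+1], their removal being charged to the ancestors of level [m]. *)
Fixpoint survivors n : set (cinterval R) :=
  if n is k.+1 then
    [set b' | (exists2 b, survivors k b & splitS b N b') /\
              forall m, (m <= k)%N -> ~ H m k b']
  else [set B].

Hypothesis N_gt0 : (0 < N)%N.

Lemma survivors_ancestor m n b' : (m <= n)%N -> survivors n b' ->
  exists2 b, survivors m b & splitS b (N ^ (n - m)) b'.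
Proof.
elim: n b' => [|n IH] b'.
  by rewrite leqn0 => /eqP -> Hb; exists b' => //; exact: splitS1.
rewrite leq_eqVlt => /predU1P[-> Hb|].
  by exists b' => //; rewrite subnn; exact: splitS1.
rewrite ltnS => mn [[b1 /(IH _ mn)[b Hb b1b] b'b1] _].
by exists b => //; rewrite subSn//; exact: splitS_exp_step b1b b'b1.
Qed.

Lemma survivors_splitS n b : survivors n b -> splitS B (N ^ n) b.
Proof. by move=> /(survivors_ancestor (leq0n n))[_ ->]; rewrite subn0. Qed.

(** The bound is asked for every level-[m] interval, surviving or not, so discards can be counted
    without knowing the earlier removals. *)
Lemma survivors_cantor_set (r : nat -> nat -> R) :
  (forall m n b, (m <= n)%N -> splitS B (N ^ m) b ->
     card_at_most (splitS b (N ^ (n - m).+1) `&` H m n) (r m n)) ->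
  cantor_set B N r (\bigcap_n \bigcup_(b in survivors n) cset b).
Proof.
(* [Is n m] records the discards charged to levels [m] to [n]: none when [m = n.+1], all when
   [m = 0]. *)
move=> Hr; pose Is n m := [set b' | (exists2 b, survivors n b & splitS b N b') /\
  forall k, (m <= k <= n)%N -> ~ H k n b'].
exists survivors, Is; split=> //.
- move=> n; apply/seteqP; split=> b'; first by move=> [[b sb bb'] _]; exists b.
  by move=> [b sb bb']; split; [exists b | move=> k; rewrite ltnNge andNb].
- move=> n m mn.
  exists (fun b => splitS b (N ^ (n - m).+1) `&` Is n m.+1 `&` H m n); split.
    move=> b sb; split; first by move=> b' [].
    have [k kr Hk] := Hr _ _ _ mn (survivors_splitS sb).
    exists k => //; apply: card_le_trans Hk.
    by apply: subset_card_le => b' [[]].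
  apply/seteqP; split=> b'.
    move=> [Hb Hk]; split.
      by split=> // k /andP[mk kn]; apply: Hk; rewrite kn ltnW.
    by move=> [b sb [_ Hm]]; apply: (Hk m) => //; rewrite leqnn.
  move=> [[[b sb bb'] Hk] Hm]; split; first by exists b.
  move=> k /andP[]; rewrite leq_eqVlt => /predU1P[<- _ Hb'|mk kn]; last first.
    by apply: Hk; rewrite mk.
  (* A candidate in [H m n] lies under a surviving level-[m] ancestor, so the removal there reaches
     it. *)
  apply: Hm; have [b1 sb1 b1b] := survivors_ancestor mn sb.
  exists b1 => //; split=> //; split; first exact: splitS_exp_step b1b bb'.
  by split=> //; exists b.
Qed.

End Survivors.
End Splitting.

(** * Counting the intervals that come near a rational of one group *)

Section Counting.
Variables (R : realType) (a b N : nat).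
Hypotheses (a_gt1 : (1 < a)%N) (b_gt1 : (1 < b)%N) (N_gt1 : (1 < N)%N).

Lemma first_exponent_subproof m j : exists i, (N ^ m <= a ^ i * b ^ j)%N.
Proof.
exists (N ^ m)%N; apply: leq_trans (ltnW (ltn_expl _ a_gt1)) _.
by rewrite leq_pmulr // expn_gt0 ltnW.
Qed.

Definition first_exponent m j := ex_minn (first_exponent_subproof m j).

(** As [a >= 2], raising [i] by [N] multiplies the product by at least [2^N > N], which leaves the
    window. The bound on [j] comes from [2^j <= a^i b^j < N^(m+1) <= 2^((m+1)N)]. *)
Lemma exponents_window m i j : (N ^ m <= a ^ i * b ^ j < N ^ m.+1)%N ->
  (j < m.+1 * N)%N /\ (first_exponent m j <= i < first_exponent m j + N)%N.
Proof.
move=> /andP[qge qlt]; split.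
  rewrite -(ltn_exp2l _ _ (isT : 1 < 2)%N).
  have h1 : (2 ^ j <= a ^ i * b ^ j)%N.
    apply: leq_trans (leq_pmull _ _); first by case: (j) => // k; rewrite leq_exp2r.
    by rewrite expn_gt0 ltnW.
  have h2 : (N ^ m.+1 <= 2 ^ (m.+1 * N))%N.
    by rewrite mulnC expnM leq_exp2r // ltnW // ltn_expl.
  by lia.
rewrite /first_exponent; case: ex_minnP => k kge kmin; rewrite kmin //=.
have ki : (k <= i)%N by exact: kmin.
rewrite -ltn_subLR // -(ltn_exp2l _ _ (isT : 1 < 2)%N).
apply: leq_trans (ltnW (ltn_expl N (isT : 1 < 2)%N)).
have Nm0 : (0 < N ^ m)%N by rewrite expn_gt0 ltnW.
rewrite -(ltn_pmul2l Nm0) -expnSr; apply: leq_ltn_trans qlt.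
rewrite -{2}(subnK ki) expnD -mulnA mulnC leq_mul //.
by case: (i - k)%N => // l; rewrite leq_exp2r.
Qed.

(* The intervals that must be discarded because of the denominators
   [q = a^i b^j] with [N^m <= q < N^(m+1)]. *)
Definition near_rational m (eta : R) : set (cinterval R) :=
  [set I | exists i j (p : int) (x : R),
     [/\ (N ^ m <= a ^ i * b ^ j < N ^ m.+1)%N, cset I x
       & `|(a ^ i * b ^ j)%:R * x - p%:~R| < eta]].

Lemma card_near_rational m L (I : cinterval R) :
  I.2 - I.1 = (N ^ m)%:R^-1 ->
  (splitS I (N ^ L) `&` near_rational m (N ^ L)%:R^-1 #<=
     `I_(m.+1 * N * N * N.+2 * 3))%card.
Proof.
(* A discarded subinterval is determined by [j], the offset [e] of [i] from
   [first_exponent m j], the offset [l] of [p] from [floor (q * x0)], and the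
   offset [h] of its index from that of the subinterval containing [p / q]. *)
move=> wI; set x0 := I.1; set d := (I.2 - I.1) / (N ^ L)%:R.
pose q (j : nat) (e : nat) : R := (a ^ (first_exponent m j + e) * b ^ j)%:R.
pose p j e (l : nat) : int := Num.floor (q j e * x0) + l%:Z.
pose k j e l (h : nat) : int :=
  Num.floor (((p j e l)%:~R / q j e - x0) / d) - 1 + h%:Z.
pose F (z : 'I_(m.+1 * N) * 'I_N * 'I_N.+2 * 'I_3) : cinterval R :=
  let: (j, e, l, h) := z in
  (x0 + (k j e l h)%:~R * d, x0 + (k j e l h + 1)%:~R * d).
have -> : (m.+1 * N * N * N.+2 * 3 =
    #|{: 'I_(m.+1 * N) * 'I_N * 'I_N.+2 * 'I_3}|)%N by rewrite !card_prod !card_ord.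
apply: (@card_le_range _ _ F) => _ [[t /= tL <-] [i [j [r [x [qm tx rx]]]]]].
have [jm /andP[fi iN]] := exponents_window qm.
move: tx; rewrite /cset /= in_itv /= /split_point -/x0 -/d => /andP[tx xt].
pose e := (i - first_exponent m j)%N.
have eN : (e < N)%N by rewrite /e ltn_subLR.
have qE : q j e = (a ^ i * b ^ j)%:R by rewrite /q /e subnKC.
have NL0 : 0 < (N ^ L)%:R :> R by rewrite ltr0n expn_gt0 ltnW.
have Nm0 : 0 < (N ^ m)%:R :> R by rewrite ltr0n expn_gt0 ltnW.
have dE : d * (N ^ m)%:R * (N ^ L)%:R = 1.
  by rewrite /d wI; field; rewrite !lt0r_neq0.
have d0 : 0 < d by rewrite /d wI divr_gt0 // invr_gt0.
rewrite -qE in rx.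
have [qlo qhi] : (N ^ m)%:R <= q j e /\ q j e < (N ^ m)%:R * N%:R.
  by rewrite qE -natrM -expnSr ler_nat ltr_nat; apply/andP.
have q0 : 0 < q j e by lra.
(* Since [N^-L = d N^m <= d q], the point [x] is within one subinterval width [d] of [r / q]. *)
have /andP[rx1 rx2] : - d * q j e < q j e * x - r%:~R < d * q j e.
  rewrite mulNr -ltr_norml; apply: lt_le_trans rx _.
  rewrite -(ler_pM2r NL0) mulVf ?lt0r_neq0 //.
  by rewrite -[leLHS]dE ler_pM2r // ler_pM2l.
have /andP[ry1 ry2] : -1 < q j e * x - r%:~R < 1.
  rewrite -ltr_norml; apply: lt_le_trans rx _.
  by rewrite invf_le1 // ler1n expn_gt0 ltnW.
have tL' : t%:R + 1 <= (N ^ L)%:R :> R by rewrite natr1 ler_nat.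
have xx0 : x0 <= x by apply: le_trans tx; rewrite lerDl mulr_ge0 // ltW.
have xx1 : q j e * (x - x0) <= N%:R.
  have h : x - x0 <= (N ^ m)%:R^-1.
    rewrite lerBlDl; apply: le_trans xt _; rewrite lerD2l -natr1.
    have -> : (N ^ m)%:R^-1 = (N ^ L)%:R * d.
      by rewrite /d wI mulrC divfK ?lt0r_neq0.
    by rewrite ler_pM2r.
  apply: (@le_trans _ _ ((N ^ m)%:R * N%:R * (N ^ m)%:R^-1)).
    by apply: ler_pM => //; lra.
  by rewrite mulrAC divff ?mul1r ?lt0r_neq0.
have /andP[f1 f2] := floor_itv (q j e * x0).
set f := Num.floor (q j e * x0) in f1 f2.
have rf0 : (f <= r)%R.
  rewrite -ltzD1 -(ltr_int R) intrD; move: (ler_wpM2l (ltW q0) xx0); lra.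
have rf1 : (r < f + N.+2%:Z)%R.
  rewrite -(ltr_int R) intrD -pmulrn -!natr1; rewrite intrD in f2; lra.
pose l := absz (r - f)%R.
have lE : l%:Z = r - f by rewrite /l gez0_abs // subr_ge0.
have lN : (l < N.+2)%N by rewrite -ltz_nat lE ltrBlDl.
have pE : p j e l = r by rewrite /p lE addrC subrK.
(* [y] locates [r / q] relative to [x0] in units of [d]. As [x] is in subinterval [t] and within [d]
   of [r / q], [y - 2 < t < y + 1], which leaves three values of [t]. *)
set y : R := (r%:~R / q j e - x0) / d.
have yE : r%:~R = (y * d + x0) * q j e.
  by rewrite /y divfK ?lt0r_neq0 // subrK divfK ?lt0r_neq0.
have /andP[g1 g2] := floor_itv y.
set g := Num.floor y in g1 g2.
have ky1 : t%:R < y + 1.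
  rewrite -(ltr_pM2r d0) -(ltr_pM2r q0).
  have := ler_wpM2r (ltW q0) tx; lra.
have ky2 : y - 2 < t%:R.
  rewrite -(ltr_pM2r d0) -(ltr_pM2r q0).
  have := ler_wpM2r (ltW q0) xt; rewrite -natr1; lra.
have tg0 : (g - 1 <= t%:Z)%R.
  rewrite -ltzD1 -(ltr_int R) !intrD -pmulrn; lra.
have tg1 : (t%:Z < g - 1 + 3%:Z)%R.
  rewrite -(ltr_int R) !intrD -!pmulrn; rewrite intrD in g2; lra.
pose h := absz (t%:Z - (g - 1))%R.
have hE : h%:Z = t%:Z - (g - 1) by rewrite /h gez0_abs // subr_ge0.
have hN : (h < 3)%N by rewrite -ltz_nat hE ltrBlDl.
exists (Ordinal jm, Ordinal eN, Ordinal lN, Ordinal hN) => //=.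
have -> : k j e l h = t%:Z by rewrite /k pE -/y -/g hE addrC subrK.
by rewrite -natr1 intrD -pmulrn.
Qed.

End Counting.

(** * Size estimates in terms of the group index *)

Lemma logstar_ge (R : realType) (N m q : nat) :
  (expR 1 <= N%:R :> R) -> (N ^ m <= q)%N -> m.+1%:R / 2 <= logstar (q%:R : R).
Proof.
move=> eN Nq; rewrite /logstar; have e0 := expR_gt0 (1 : R).
have Nq' : N%:R ^+ m <= q%:R :> R by rewrite -natrX ler_nat.
have N0 : 0 < N%:R :> R by apply: lt_le_trans eN.
(* If [q < e] then [m = 0], because [N >= e]; otherwise [ln q] is at least both [1] and [m], hence
   at least their mean. *)
case: ltP => [qe|eq].
  case: m Nq Nq' => [|m] Nq Nq'; first by lra.
  suff : N%:R <= q%:R :> R by lra.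
  apply: le_trans Nq'; rewrite exprS ler_peMr ?(ltW N0) // exprn_ege1 //.
  by rewrite (le_trans _ eN) // -expR0 ler_expR.
have l1 : 1 <= ln N%:R :> R by rewrite -[leLHS]expRK ler_ln ?posrE.
have lq1 : 1 <= ln q%:R :> R.
  by rewrite -[leLHS]expRK ler_ln ?posrE // (lt_le_trans e0).
have lqm : m%:R <= ln q%:R :> R.
  apply: (@le_trans _ _ (ln (N%:R ^+ m))).
    by rewrite lnXn // -[leRHS]mulr_natl ler_peMr.
  by rewrite ler_ln ?posrE ?exprn_gt0 // (lt_le_trans e0).
by rewrite -natr1; lra.
Qed.

Lemma power_above (R : realType) (N : nat) (y : R) : (1 < N)%N -> 1 <= y ->
  exists t : nat, y <= N%:R ^+ t <= N%:R * y.
Proof.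
move=> N1 y1; have ex : exists t : nat, y <= N%:R ^+ t.
  exists (Num.bound y).
  have y0 : 0 <= y by lra.
  apply: le_trans (ltW (archi_boundP y0)) _.
  by rewrite -natrX ler_nat ltnW // ltn_expl.
have N1' : 1 < N%:R :> R by rewrite ltr1n.
case: (ex_minnP ex) => [[|t] yt tmin]; [exists 0%N|exists t.+1]; rewrite yt /=.
  by rewrite expr0 mulr_ege1 // ltW.
rewrite exprS ler_pM2l; last by lra.
by rewrite leNgt; apply/negP => /ltW /tmin; rewrite ltnn.
Qed.

(** The count is at most [(m+1) N^4]; [N^(t s)] absorbs [m+1], and [N^(D s)] absorbs [N^4]. *)
Lemma count_le_power (R : realType) (N m t D : nat) (eps s : R) :
  (6 <= N)%N -> 0 < eps -> (1 + eps)^-1 <= s -> 4 <= D%:R * s ->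
  m.+1%:R `^ (1 + eps) <= N%:R ^+ t ->
  (m.+1 * N * N * N.+2 * 3)%:R <= N%:R `^ ((t + D)%:R * s).
Proof.
move=> N6 eps0 es Ds mt.
have N1 : 1 <= N%:R :> R by rewrite ler1n; lia.
have N0 : 0 < N%:R :> R by lra.
have e0 : 0 < 1 + eps by lra.
apply: (@le_trans _ _ (m.+1%:R * N%:R ^+ 4)).
  rewrite -natrX -natrM ler_nat; nia.
rewrite natrD mulrDl powRD; last by rewrite (gt_eqF N0) implybT.
rewrite ler_pM ?exprn_ge0 //.
- apply: (@le_trans _ _ (N%:R `^ (t%:R * (1 + eps)^-1))); last first.
    by rewrite ler_powR // ler_wpM2l.
  rewrite powRrM powR_mulrn; last exact: ltW.
  have -> : m.+1%:R = (m.+1%:R `^ (1 + eps)) `^ (1 + eps)^-1 :> R.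
    by rewrite -powRrM divff ?powRr1 // gt_eqF.
  by apply: ge0_ler_powR => //; rewrite ?nnegrE ?invr_ge0 ?powR_ge0 ?exprn_ge0 // ltW.
- by rewrite -powR_mulrn ?ler_powR // ltW.
Qed.

(** * Multiplicative independence, and the choice of parameters *)

Lemma mult_indep_gt1 (a b : nat) : (0 < a)%N -> mult_indep a b -> (1 < a)%N.
Proof.
case: a => [//|[|//]] _ /(_ 1 0).
by rewrite expr1z expr0z mulr1 => /(_ erefl)[].
Qed.

Lemma mult_indep_sym (a b : nat) : mult_indep a b -> mult_indep b a.
Proof. by move=> ab n m; rewrite mulrC => /ab[]. Qed.

Theorem theorem17 (R : realType) (a b : nat) (eps : R)
    (ha : (0 < a)%N) (hb : (0 < b)%N) (hab : mult_indep a b)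
    (heps : 0 < eps) :
  cantor_winning (eps / (1 + eps)) ((0, 1) : cinterval R)
    (Bad a b (fun q : R => logstar q `^ (1 + eps)) `&` `[0, 1]%classic).
Proof.
move=> eps' eps'0 eps'lt.
have a1 := mult_indep_gt1 ha hab.
have b1 := mult_indep_gt1 hb (mult_indep_sym hab).
have e0 : 0 < 1 + eps by lra.
have es : (1 + eps)^-1 <= 1 - eps'.
  suff : eps / (1 + eps) = 1 - (1 + eps)^-1 by lra.
  by field; rewrite gt_eqF.
have s0 : 0 < 1 - eps' by apply: lt_le_trans es; rewrite invr_gt0.
set s := 1 - eps' in es s0 *.
have [D D4] : exists D : nat, 4 <= D%:R * s.
  exists (Num.bound (4 / s)); rewrite -ler_pdivrMr //.
  by apply/ltW/archi_boundP; rewrite divr_ge0 // ltW.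
have D0 : (0 < D)%N by case: D D4 => //; rewrite mul0r; lra.
exists (maxn 6 (Num.bound (expR 1 : R))) => N; rewrite geq_max => /andP[N6 eN].
have N1 : (1 < N)%N by lia.
have N0 : 0 < N%:R :> R by rewrite ltr0n; lia.
have {}eN : expR 1 <= N%:R :> R.
  by apply: le_trans (ltW (archi_boundP (expR_ge0 _))) _; rewrite ler_nat.
have /choice[t tP] : forall m : nat, exists k : nat,
    m.+1%:R `^ (1 + eps) <= N%:R ^+ k <= N%:R * m.+1%:R `^ (1 + eps).
  move=> m; apply: power_above => //.
  by rewrite -[leLHS](powRr0 m.+1%:R) ler_powR ?ler1n // ltW.
pose L m := (t m + D)%N.
(* Group [m] is handled once, in forming level [m + L m], and charged to level [m]. *)
pose H m n : set (cinterval R) :=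
  if n.+1 == (m + L m)%N then near_rational a b N m (N ^ L m)%:R^-1 else set0.
exists (\bigcap_n \bigcup_(I in survivors (0, 1) N H n) cset I).
  apply: survivors_cantor_set => [|m n I mn HI]; first by lia.
  rewrite /H; case: eqP => [nE|_]; last first.
    by rewrite setI0; exists 0%N; rewrite ?powR_ge0.
  have LE : (n - m).+1 = L m by lia.
  rewrite LE; exists (m.+1 * N * N * N.+2 * 3)%N.
    by apply: (count_le_power (eps := eps)) => //; case/andP: (tP m).
  apply: card_near_rational => //.
  by rewrite (splitS_width HI) subr0 mul1r.
move=> x Kx; split; last by have [_ ->] := Kx 0%N I.
(* One factor [N^-1] pays for the overshoot of [N^t], and [2^-(1+eps)] for the halving in
   [logstar_ge]. *)
exists (N%:R ^- D.+1 * 2^-1 `^ (1 + eps)).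
  by rewrite mulr_gt0 ?powR_gt0 // invr_gt0 exprn_gt0.
move=> _ [i [j ->]]; set q := (a ^ i * b ^ j)%N.
have q0 : (0 < q)%N by rewrite muln_gt0 !expn_gt0 ha hb.
have qN := trunc_log_bounds N1 q0.
set m := trunc_log N q in qN; rewrite /= in qN.
have mL : (m + L m).-1.+1 = (m + L m)%N by rewrite /L; lia.
have mn : (m <= (m + L m).-1)%N by rewrite /L; lia.
have [I' [_ /(_ m mn)]] := Kx (m + L m).-1.+1 I.
rewrite /H mL eqxx => nearN xI; rewrite leNgt; apply/negP => small.
apply: nearN.
(* The strict inequality on the infimum yields an actual integer [p]. *)
have [|_ [p _ <-] xp] := inf_lt _ small.
  by exists `|q%:R * x - (0 : int)%:~R|; exists 0.
exists i, j, p, x; split=> //; apply: lt_le_trans xp _.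
set G := logstar _ `^ _; set T := _ `^ _.
have T0 : 0 < T by rewrite powR_gt0.
have /andP[_ tN] := tP m.
set P := m.+1%:R `^ _ in tN.
have P0 : 0 < P by rewrite powR_gt0.
have PTG : P * T <= G.
  have lq : m.+1%:R * 2^-1 <= logstar (q%:R : R).
    by apply: logstar_ge eN _; case/andP: qN.
  rewrite -powRM //; apply: ge0_ler_powR => //; first exact: ltW.
  - by rewrite nnegrE mulr_ge0.
  - by rewrite nnegrE; apply: le_trans lq; rewrite mulr_ge0.
have G0 : 0 < G by apply: lt_le_trans PTG; rewrite mulr_gt0.
have B0 : 0 < N%:R ^+ t m :> R by rewrite exprn_gt0.
have A0 : 0 < N%:R ^+ D :> R by rewrite exprn_gt0.
(* After cancelling [N^(D+1)] the goal is [N^t T <= N G], from [N^t <= N P] and [P T <= G]. *)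
rewrite natrX exprD exprS.
have -> : (N%:R ^+ t m * N%:R ^+ D)^-1 =
    (N%:R * N%:R ^+ D)^-1 * (N%:R / N%:R ^+ t m) :> R.
  by field; rewrite !gt_eqF.
rewrite -mulrA ler_pM2l ?invr_gt0 ?mulr_gt0 // ler_pdivrMr // mulrAC.
rewrite ler_pdivlMr // mulrC; apply: le_trans (ler_wpM2r (ltW T0) tN) _.
by rewrite -mulrA ler_pM2l.
Qed.
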